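(* Let $k$ be a field of characteristic zero, $m\ge 2$, let $R=k[x_{i,j}\mid 1\le i,j\le m,\ (i,j)\ne(m,m)]$, let $\mathcal{GC}$ be the $m\times m$ diagonally cloned generic matrix over $R$ (the matrix whose $(i,j)$-entry is $x_{i,j}$ for $(i,j)\neq (m,m)$ and whose $(m,m)$-entry is $x_{m-1,m-1}$), and let $f=\det(\mathcal{GC})$. Then: (i) $f$ is irreducible. (ii) The Hessian determinant $h(f)$ does not vanish (i.e. it is a nonzero polynomial). (iii) The linear rank of the gradient ideal of $f$ is $m^2-2$ (the maximum possible). (iv) $f$ is homaloidal.
   Context: The $x_{i,j}$ with $(i,j)\ne (m,m)$ are $m^2-1$ independent variables over $k$; $R$ is standard graded. The gradient (Jacobian) ideal $J$ of $f$ is the ideal of $R$ generated by the partial derivatives of $f$ with respect to all the variables of $R$. The Hessian determinant $h(f)$ is the determinant of the Hessian matrix $H(f)$ of second partial derivatives of $f$ with respect to these variables. Linear rank: if an ideal $I\subset R$ is minimally generated by $n+1$ forms of the same degree, its linear rank is the rank (over the fraction field of $R$) of the matrix whose columns are the linear syzygies of these generators, i.e. the relations on the generators whose coefficients are linear forms (degree $1$) of $R$; it does not depend on the choice of minimal generators and it is at most $n$. Homaloidal: the polar map of $f$ is the rational map $\mathbb{P}^{m^2-2}\dashrightarrow\mathbb{P}^{m^2-2}$ whose coordinates are the partial derivatives of $f$; $f$ is homaloidal if this map is birational (a Cremona map). *)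

(* Defs.v *)
From HB Require Import structures.
From mathcomp Require Import all_boot all_order all_algebra.
From mathcomp Require Import mpoly.

Set Implicit Arguments.
Unset Strict Implicit.
Unset Printing Implicit Defensive.

Import GRing.Theory.
Local Open Scope ring_scope.

Definition irreducible_element (R : idomainType) (p : R) : Prop :=
  [/\ p != 0, p \isn't a GRing.unit
    & forall a b : R, p = a * b -> a \is a GRing.unit \/ b \is a GRing.unit].

Section Polar.
Variables (k : fieldType) (n : nat).
Local Notation R := {mpoly k[n]}.

Definition gradient (f : R) : n.-tuple R := [tuple f^`M(i) | i < n].

Definition hessian (f : R) : 'M[R]_n := \matrix_(i < n, j < n) f^`M(i)^`M(j).

Definition hessian_det (f : R) : R := \det (hessian f).

Definition ideal_gen (q : nat) (g : q.-tuple R) (p : R) : Prop :=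
  exists a : 'I_q -> R, p = \sum_(i < q) a i * tnth g i.

Definition gradient_ideal (f : R) : R -> Prop := ideal_gen (gradient f).

Definition minimally_generates (q : nat) (g : q.-tuple R) (I : R -> Prop) :=
  (forall p, I p <-> ideal_gen g p) /\
  (forall i : 'I_q,
     ~ exists a : 'I_q -> R, tnth g i = \sum_(j < q | j != i) a j * tnth g j).

Definition linear_syzygy (q : nat) (g : q.-tuple R) (s : 'cV[R]_q) : Prop :=
  (forall i, s i 0 \is 1.-homog) /\ \sum_(i < q) s i 0 * tnth g i = 0.

(* The matrix of all linear syzygies has infinitely many columns.  Its rank   *)
(* over the fraction field is read off any finite selection M of its columns  *)
(* that spans its column space.                                               *)
Definition linear_syzygies_have_rank (q : nat) (g : q.-tuple R) (r : nat) :=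
  exists (c : nat) (M : 'M[R]_(q, c)),
    [/\ forall j, linear_syzygy g (col j M),
        forall s : 'cV[R]_q, linear_syzygy g s ->
          exists w : 'cV[{fraction R}]_c,
            map_mx (@tofrac R) s = map_mx (@tofrac R) M *m w
      & \rank (map_mx (@tofrac R) M) = r].

(* I is minimally generated by q forms of the same degree and has linear rank *)
(* r; neither q nor r depends on the minimal generators g.  The bound on the  *)
(* linear rank is r <= q - 1.                                                 *)
Definition has_linear_rank (I : R -> Prop) (q r : nat) : Prop :=
  exists (g : q.-tuple R) (d : nat),
    [/\ forall i, tnth g i \is d.-homog,
        minimally_generates g I
      & linear_syzygies_have_rank g r].

(* A rational self-map of P^(n-1) is represented by n forms of the same       *)
(* degree, not all zero (common factors are allowed).                         *)
Definition is_rational_map (F : n.-tuple R) : Prop :=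
  (exists d : nat, forall i, tnth F i \is d.-homog) /\
  (exists i, tnth F i != 0).

Definition same_rational_map (F G : n.-tuple R) : Prop :=
  forall i j, tnth F i * tnth G j = tnth F j * tnth G i.

Definition id_map : n.-tuple R := [tuple 'X_i | i < n].

(* The rational map "G after F". *)
Definition comp_map (G F : n.-tuple R) : n.-tuple R :=
  [tuple tnth G i \mPo F | i < n].

(* The composite G o F is defined as a rational map and is the identity;      *)
(* being defined means that F does not map into the base locus of G.          *)
Definition left_inverse_map (G F : n.-tuple R) : Prop :=
  is_rational_map (comp_map G F) /\ same_rational_map (comp_map G F) id_map.

Definition birational (F : n.-tuple R) : Prop :=
  is_rational_map F /\
  exists G : n.-tuple R,
    [/\ is_rational_map G, left_inverse_map G F & left_inverse_map F G].

Definition homaloidal (f : R) : Prop := birational (gradient f).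

End Polar.

Section ClonedMatrix.
Variables (m : nat) (hm : (2 <= m)%N).

(* With 0-based indices, the variable in position (i, j) other than           *)
(* (m-1, m-1) is numbered i * m + j (row by row), and position (m-1, m-1)     *)
(* repeats the variable in position (m-2, m-2).                               *)
Definition cloned_index (i j : 'I_m) : nat :=
  if (i == m.-1 :> nat) && (j == m.-1 :> nat) then ((m - 2) * m + (m - 2))%N
  else (i * m + j)%N.

Lemma cloned_index_lt (i j : 'I_m) : (cloned_index i j < m ^ 2 - 1)%N.
Proof.
move: (ltn_ord i) (ltn_ord j); rewrite /cloned_index -mulnn.
have m1 : (m * m - 1 = m.-1 * m + m.-1)%N.
  by case: m hm => [//|p] _ /=; rewrite [in LHS]mulSn addSn subn1 addnC.
rewrite m1; have m0 : (0 < m)%N := ltnW hm.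
have m2 : (m - 2 < m.-1)%N by rewrite -subn1 ltn_sub2l.
case: ifPn => [_ _ _|]; first by rewrite -addnS leq_add // leq_mul2r ltnW ?orbT.
have lem (p : nat) : (p < m)%N -> (p <= m.-1)%N by move=> h; rewrite -ltnS prednK.
rewrite negb_and => /orP[ni|nj] /lem hi /lem hj.
- have ip : (i < m.-1)%N by rewrite ltn_neqAle ni.
  apply: (@leq_trans (i.+1 * m)); first by rewrite mulSn addnC ltn_add2r.
  by apply: leq_trans (leq_addr _ _); rewrite leq_mul2r ip orbT.
- have jp : (j < m.-1)%N by rewrite ltn_neqAle nj.
  by rewrite -addnS leq_add // leq_mul2r hi orbT.
Qed.

Definition cloned_generic_matrix (k : fieldType) :
    'M[{mpoly k[m ^ 2 - 1]}]_m :=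
  \matrix_(i < m, j < m) 'X_(Ordinal (cloned_index_lt i j)).

End ClonedMatrix.

(* Main.v *)
From HB Require Import structures.
Require Import Defs.
From mathcomp Require Import all_boot all_order all_fingroup all_algebra.
From mathcomp Require Import mpoly ring.
Import GRing.Theory.
Local Open Scope ring_scope.

Set Implicit Arguments.
Unset Strict Implicit.
Unset Printing Implicit Defensive.

(* Write X for the cloned matrix, a and b for its last two indices and        *)
(* D = E_aa - E_bb.  The partial derivatives of f = det X are the cofactors   *)
(* of X, except that only the sum of the two cofactors at (a, a) and (b, b)   *)
(* is seen; so the polar image of X determines a matrix Y such that           *)
(* 2 cof X = Y + t D for an unknown t.  Since adj (cof X) is proportional to  *)
(* the transpose of X, its entries at (a, a) and (b, b) agree, and this       *)
(* condition on Y + t D is linear in t with leading coefficient the minor of  *)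
(* Y away from a and b.  Solving for t and taking the adjugate gives an       *)
(* explicit rational inverse of the polar map.                                *)
(*                                                                            *)
(* The Hessian cannot be singular, because a derivation killing the partials  *)
(* of f kills G o F = h X, hence is proportional to the Euler derivation.     *)
(* Linear syzygies come from the vector fields A X + X B with                 *)
(* tr A + tr B = 0 tangent to the space of cloned matrices; at X = 1 they     *)
(* span a hyperplane, and the rank can only drop under specialization.        *)
(*                                                                            *)
(* For irreducibility, f has degree 1 in the variables of row a other than    *)
(* X_aa, so one factor p of f = p q does not involve them.  Specializing that *)
(* row shows that p divides X_aa C_aa and every other cofactor C_aj, so p     *)
(* is free of every column apart from the cloned variable c.  Finally p       *)
(* survives the specialization of X to the identity with corner               *)
(* (c, 1; c^2 - 1, c), whose determinant is 1.                                *)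

(** * Determinants and adjugates *)

(** The core is an explicit inverse of the polar map, built from adjugates and [balance] over an
    abstract [clone_pattern]. The two composites multiply the identity map by [left_factor] and
    [right_factor] ([inverse_map_gradient], [gradient_inverse_map]), which are nonzero because they
    do not vanish at the identity matrix and at its polar image respectively. Homaloidness follows
    at once; composing with the inverse also gives the Hessian ([cloned_det_hessian]) and the
    minimality of the partials as generators ([cloned_gradient_minimal]). The linear rank comes from
    [cloned_field], one determinant-preserving linear field per variable, and [linear_rank_point],
    which bounds the rank from below at the identity matrix. Irreducibility reduces to
    [row_free_factor_unit]. *)

Lemma ord_neq_gt1 m (a b : 'I_m) : a != b -> (1 < m)%N.
Proof.
move=> ab; have := max_card (mem [set a; b]); rewrite card_ord.
by apply: leq_trans; rewrite cards2 ab.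
Qed.

Lemma card_off_pair m (a b : 'I_m) : a != b ->
  #|[pred i | ~~ ((i == a) || (i == b))]| = m.-2.
Proof.
move=> ab; have := cardC [pred i | i \in [set a; b]]; rewrite card_ord.
have -> : #|[pred i | i \in [set a; b]]| = 2.
  by transitivity #|[set a; b]|; [apply: eq_card | rewrite cards2 ab].
move=> /(congr1 (fun c => c.-2)) <-; rewrite add2n /=; apply: eq_card => i.
by rewrite !inE.
Qed.

Section CofactorLemmas.
Variables (R : comNzRingType) (m : nat).
Implicit Types (A B : 'M[R]_m) (a b i j : 'I_m) (x t : R).

Lemma cofactor_eq A B i j :
    (forall i' j', i' != i -> j' != j -> A i' j' = B i' j') ->
  cofactor A i j = cofactor B i j.
Proof.
move=> eqAB; rewrite /cofactor; congr (_ * \det _).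
by apply/matrixP=> p q; rewrite !mxE eqAB // eq_sym neq_lift.
Qed.

Lemma det_unit_row A i j :
  (forall l, A i l = (l == j)%:R) -> \det A = cofactor A i j.
Proof.
move=> Ai; rewrite (expand_det_row A i) (bigD1 j) //= Ai eqxx mul1r big1 ?addr0 //.
by move=> l /negPf lj; rewrite Ai lj mul0r.
Qed.

(** Putting unit rows in place of deleted rows keeps the size m, so that the principal minors off
    [a] (taking [b = a]) and off both [a] and [b] are determinants of m x m matrices. *)
Definition unit_rows a b A : 'M[R]_m :=
  \matrix_(i, j) if (i == a) || (i == b) then (i == j)%:R else A i j.

Lemma cofactor_diag A a : cofactor A a a = \det (unit_rows a a A).
Proof.
rewrite (det_unit_row (i := a) (j := a)) => [|l]; last by rewrite mxE eqxx eq_sym.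
by apply: cofactor_eq => i j /negPf ia _; rewrite mxE ia.
Qed.

Lemma det_add_delta A b t :
  \det (A + t *: delta_mx b b) = \det A + t * cofactor A b b.
Proof.
rewrite (expand_det_row _ b) (expand_det_row A b).
rewrite (bigD1 b) //= [in RHS](bigD1 b) //=.
have cE j : cofactor (A + t *: delta_mx b b) b j = cofactor A b j.
  by apply: cofactor_eq => p q /negPf pb _; rewrite !mxE pb mulr0 addr0.
rewrite cE !mxE !eqxx mulr1 mulrDl addrAC; congr (_ + _ + _).
by apply: eq_bigr => j /negPf jb; rewrite cE !mxE jb andbF mulr0 addr0.
Qed.

Definition corner_det a b A : R := \det (unit_rows a b A).

Lemma corner_detC a b A : corner_det a b A = corner_det b a A.
Proof.
by congr (\det _); apply/matrixP=> i j; rewrite !mxE orbC.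
Qed.

Lemma corner_detZ a b x A : a != b ->
  corner_det a b (x *: A) = x ^+ m.-2 * corner_det a b A.
Proof.
move=> ab; pose r : 'rV[R]_m := \row_i if (i == a) || (i == b) then 1 else x.
have -> : corner_det a b (x *: A) = \det (diag_mx r *m unit_rows a b A).
  congr (\det _); rewrite mul_diag_mx; apply/matrixP=> i j.
  by rewrite !mxE; case: ifP; rewrite ?mul1r.
rewrite det_mulmx det_diag; congr (_ * _).
under eq_bigr => i _ do rewrite mxE -if_neg.
by rewrite -big_mkcond prodr_const card_off_pair.
Qed.

Definition diag_gap a b A : R := \adj A a a - \adj A b b.

(** The cofactor at (a, a) does not see the entry (a, a) and is affine in the entry (b, b), with
    slope the minor off both indices. *)
Lemma cofactor_add_gap A a b t : a != b ->
  cofactor (A + t *: (delta_mx a a - delta_mx b b)) a a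
  = cofactor A a a - t * corner_det a b A.
Proof.
move=> ab; rewrite !cofactor_diag.
have -> : unit_rows a a (A + t *: (delta_mx a a - delta_mx b b)) =
          unit_rows a a A + (- t) *: delta_mx b b.
  apply/matrixP=> i j; rewrite !mxE orbb.
  have [->|ia] := eqVneq i a; first by rewrite (negPf ab) mulr0 addr0.
  by rewrite add0r mulrN mulNr.
rewrite det_add_delta mulNr; congr (_ - _ * _).
rewrite cofactor_diag; congr (\det _); apply/matrixP=> i j.
by rewrite !mxE !orbb; case: (eqVneq i b); case: (eqVneq i a).
Qed.

Lemma diag_gapD A a b t : a != b ->
  diag_gap a b (A + t *: (delta_mx a a - delta_mx b b))
  = diag_gap a b A - t * corner_det a b A *+ 2.
Proof.
move=> ab; rewrite /diag_gap !mxE cofactor_add_gap //.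
have -> : t *: (delta_mx a a - delta_mx b b) =
          (- t) *: (delta_mx b b - delta_mx a a) :> 'M_m.
  by rewrite scaleNr -scalerN opprB.
by rewrite cofactor_add_gap 1?eq_sym // corner_detC; ring.
Qed.

Lemma diag_gapZ A a b x : diag_gap a b (x *: A) = x ^+ m.-1 * diag_gap a b A.
Proof. by rewrite /diag_gap adjZ !mxE mulrBr. Qed.

(* The matrix A + t (E_aa - E_bb), up to scaling, whose adjugate has equal    *)
(* entries at (a, a) and (b, b): by diag_gapD this is a linear equation in t. *)
Definition balance a b A : 'M[R]_m :=
  (corner_det a b A *+ 2) *: A
  + diag_gap a b A *: (delta_mx a a - delta_mx b b).

Lemma balanceE a b A i j : balance a b A i j =
  (corner_det a b A *+ 2) * A i j + diag_gap a b A *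
  (((i == a) && (j == a))%:R - ((i == b) && (j == b))%:R).
Proof. by rewrite !mxE. Qed.

Lemma diag_gap_balance a b A : a != b -> diag_gap a b (balance a b A) = 0.
Proof.
move=> ab; rewrite diag_gapD // diag_gapZ corner_detZ //.
have -> : m.-1 = m.-2.+1 by case: (m) (ord_neq_gt1 ab) => [|[]].
by rewrite exprSr; ring.
Qed.

End CofactorLemmas.

Lemma adj_adj (R : idomainType) m (A : 'M[R]_m) : (1 < m)%N -> \det A != 0 ->
  \adj (\adj A) = \det A ^+ m.-2 *: A.
Proof.
case: m A => [|[|p]] // A _ dA /=.
have dadj : \det (\adj A) = \det A ^+ p.+1.
  apply: (mulfI dA); rewrite -det_mulmx mul_mx_adj det_scalar -exprS //.
apply: (scalemx_inj dA).
rewrite -mul_mx_scalar -(mul_adj_mx A) mulmxA mul_adj_mx dadj mul_scalar_mx.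
by rewrite scalerA -exprS.
Qed.

Section Derivation.
Variables (R : comNzRingType) (D : R -> R).
Hypotheses (D0 : D 0 = 0) (DD : {morph D : x y / x + y}).
Hypothesis DM : forall x y, D (x * y) = D x * y + x * D y.

Lemma derivation1 : D 1 = 0.
Proof. by apply: (addrI (D 1)); rewrite addr0 -{3}[1]mulr1 DM mulr1 mul1r. Qed.

Lemma derivationN x : D (- x) = - D x.
Proof. by apply: (addrI (D x)); rewrite -DD !subrr. Qed.

Lemma derivation_sum (I : Type) (s : seq I) (F : I -> R) :
  D (\sum_(i <- s) F i) = \sum_(i <- s) D (F i).
Proof. exact: (big_morph D DD D0). Qed.

Lemma derivation_prod (I : eqType) (s : seq I) (F : I -> R) : uniq s ->
  D (\prod_(i <- s) F i) =
  \sum_(i <- s) D (F i) * \prod_(j <- s | j != i) F j.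
Proof.
elim: s => [|x s IHs] /=; first by rewrite !big_nil derivation1.
case/andP=> xs us; rewrite !big_cons DM IHs // eqxx /=; congr (_ * _ + _).
  rewrite big_seq_cond [RHS]big_seq_cond; apply: eq_bigl => j.
  by case: eqP => [->|]; rewrite ?(negPf xs) ?andbT.
rewrite mulr_sumr; apply: eq_big_seq => i is_; rewrite big_cons.
by case: eqP is_ xs => [<- ->//|_ _ _]; rewrite mulrCA.
Qed.

(** Jacobi's formula: Leibniz on each permutation product gives a sum of determinants with one row
    differentiated ([B i]), each then expanded along that row. *)
Lemma derivation_det m (A : 'M[R]_m) :
  D (\det A) = \sum_i \sum_j D (A i j) * cofactor A i j.
Proof.
pose B i : 'M[R]_m := \matrix_(i', j) if i' == i then D (A i j) else A i' j.
transitivity (\sum_i \det (B i)); last first.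
  apply: eq_bigr => i _; rewrite (expand_det_row _ i); apply: eq_bigr => j _.
  rewrite mxE eqxx; congr (_ * _); apply: cofactor_eq => p q /negPf pi _.
  by rewrite mxE pi.
rewrite derivation_sum exchange_big /=; apply: eq_bigr => s _.
have Dsgn x : D ((-1) ^+ s * x) = (-1) ^+ s * D x.
  by case: (odd_perm s); rewrite ?mulN1r ?mul1r ?derivationN.
rewrite -mulr_sumr Dsgn derivation_prod ?index_enum_uniq //; congr (_ * _).
apply: eq_bigr => i _; rewrite [RHS](bigD1 i) //= mxE eqxx; congr (_ * _).
by apply: eq_bigr => j /negPf ji; rewrite mxE ji.
Qed.

End Derivation.

(** * Polynomials: homogeneity, Euler's identity, free variables *)

Section MPolyLemmas.
Variables (k : fieldType) (n : nat).
Local Notation R := {mpoly k[n]}.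
Implicit Types (p q : R).

Lemma mderiv_det m (A : 'M[R]_m) v :
  (\det A)^`M(v) = \sum_i \sum_j (A i j)^`M(v) * cofactor A i j.
Proof.
apply: (derivation_det (D := mderiv v)); [exact: mderiv0 | exact: mderivD | exact: mderivM].
Qed.

(** The degree may vary with the row, so that the unit rows of [unit_rows] can count as degree 0. *)
Lemma dhomog_det m (A : 'M[R]_m) (d : 'I_m -> nat) :
  (forall i j, A i j \is (d i).-homog) -> \det A \is (\sum_i d i)%N.-homog.
Proof.
move=> hA; apply: rpred_sum => s _; rewrite rpredMsign.
apply: (big_ind2 (fun p e => p \is e.-homog)) => [|p e q f hp hq|i _] //.
  exact: dhomog1.
exact: dhomogM.
Qed.

Lemma dhomog_comp p (F : n.-tuple R) d e : p \is e.-homog ->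
  (forall i, tnth F i \is d.-homog) -> p \mPo F \is (e * d)%N.-homog.
Proof.
move=> hp hF; rewrite comp_mpolyEX big_seq; apply: rpred_sum => mu pmu.
have md : mdeg mu = e := dhomog_mf hp pmu.
apply: rpredZ; rewrite comp_mpolyX -md mdegE big_distrl /=.
apply: (big_ind2 (fun q f => q \is f.-homog)) => [|q f q' f' hq hq'|i _].
- exact: dhomog1.
- exact: dhomogM.
by rewrite mulnC dhomogMn.
Qed.

Lemma euler_identity p d : p \is d.-homog ->
  \sum_i 'X_i * p^`M(i) = d%:R *: p.
Proof.
move=> hp; rewrite {1}(mpolyE p).
under eq_bigr => i _ do rewrite linear_sum mulr_sumr.
rewrite exchange_big /= [in RHS](mpolyE p) scaler_sumr.
apply: eq_big_seq => mu pmu; have md : mdeg mu = d := dhomog_mf hp pmu.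
rewrite -md mdegE natr_sum scaler_suml.
apply: eq_bigr => i _; rewrite mderivZ mderivX -!scalerAr.
rewrite scalerA [in RHS]scalerA [in RHS]mulrC.
(* Subtraction of exponents truncates at 0; when [X_i] is absent from the monomial, the coefficient
   [mu i] is 0 and both sides vanish. *)
have [->|mui] := eqVneq (mu i) 0%N; first by rewrite mulr0 !scale0r.
rewrite -mpolyXD addmC submK //; apply/mnm_lepP => j; rewrite mnm1E.
by case: eqP => [<-|//]; rewrite lt0n.
Qed.

Definition dirderiv (v : 'I_n -> R) p : R := \sum_j v j * p^`M(j).

Lemma dirderiv_mulr v p q :
  dirderiv v (p * q) = dirderiv v p * q + p * dirderiv v q.
Proof.
rewrite mulr_suml mulr_sumr -big_split; apply: eq_bigr => j _ /=.
by rewrite mderivM; ring.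
Qed.

Lemma mderivXU i v : ('X_i : R)^`M(v) = (i == v)%:R.
Proof.
rewrite mderivX mnm1E; case: eqP => [<-|_]; last by rewrite scale0r.
have -> : (U_(i) - U_(i) = 0 :> 'X_{1..n})%MM by apply/mnmP=> j; rewrite mnmBE mnm0E subnn.
by rewrite mpolyX0 scale1r.
Qed.

Lemma dirderivX v i : dirderiv v 'X_i = v i.
Proof.
rewrite /dirderiv (bigD1 i) //= mderivXU eqxx mulr1 big1 ?addr0 // => j.
by rewrite mderivXU eq_sym => /negPf->; rewrite mulr0.
Qed.

(** In place of the full chain rule: the elements killed by a derivation contain the constants and
    are closed under sums and products. *)
Lemma dirderiv_comp0 v p (F : n.-tuple R) :
  (forall i, dirderiv v (tnth F i) = 0) -> dirderiv v (p \mPo F) = 0.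
Proof.
move=> F0; have d0 : dirderiv v 0 = 0.
  by rewrite /dirderiv big1 // => j _; rewrite mderiv0 mulr0.
have dD q q' : dirderiv v (q + q') = dirderiv v q + dirderiv v q'.
  by rewrite /dirderiv -big_split; apply: eq_bigr => j _; rewrite mderivD mulrDr.
have dC c : dirderiv v c%:MP = 0.
  by rewrite /dirderiv big1 // => j _; rewrite mderivC mulr0.
rewrite comp_mpolyEX; apply: (big_ind (fun q => dirderiv v q = 0)) => //.
  by move=> q q' hq hq'; rewrite dD hq hq' addr0.
move=> mu _; rewrite -mul_mpolyC dirderiv_mulr dC mul0r add0r comp_mpolyX.
have -> : dirderiv v (\prod_(i < n) tnth F i ^+ mu i) = 0; last by rewrite mulr0.
apply: (big_ind (fun q => dirderiv v q = 0)) => [|q q' hq hq'|i _].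
- by rewrite -mpolyC1.
- by rewrite dirderiv_mulr hq hq' mul0r mulr0 addr0.
elim: (mu i) => [|e IHe]; first by rewrite expr0 -mpolyC1.
by rewrite exprS dirderiv_mulr IHe F0 mul0r mulr0 addr0.
Qed.

End MPolyLemmas.

(** * Degree in a set of variables, and factors free of these variables *)

Lemma size_factors (R : idomainType) (p q : {poly R}) : p * q != 0 ->
  exists s t, [/\ size p = s.+1, size q = t.+1 & size (p * q) = (s + t).+1].
Proof.
rewrite mulf_eq0 negb_or => /andP[p0 q0]; exists (size p).-1, (size q).-1.
by rewrite -!polySpred // size_mul // (polySpred p0) (polySpred q0) /= addnS.
Qed.

Section FreeVariables.
Variables (k : fieldType) (n : nat).
Local Notation R := {mpoly k[n]}.
Implicit Types (p q : R) (S T : pred 'I_n).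

Lemma eq_comp_mpoly p (F G : n.-tuple R) :
  (forall i, tnth F i = tnth G i) -> p \mPo F = p \mPo G.
Proof. by move=> eqFG; have -> : F = G by exact: eq_from_tnth. Qed.

Lemma comp_mpolyA p (F G : n.-tuple R) :
  (p \mPo F) \mPo G = p \mPo [tuple tnth F i \mPo G | i < n].
Proof.
rewrite [p \mPo F]comp_mpolyEX [RHS]comp_mpolyEX linear_sum; apply: eq_bigr => mu _ /=.
rewrite linearZ /= !comp_mpolyX rmorph_prod; congr (_ *: _).
by apply: eq_bigr => i _; rewrite rmorphXn /= tnth_mktuple.
Qed.

(** Multiplies each variable of [S] by a new variable, so that the degree in the latter is the joint
    degree in [S]. Evaluation at 1 gives back the polynomial; evaluation at 0 sets the variables of
    [S] to 0. *)
Definition scale_vars S : R -> {poly R} :=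
  mmap (polyC \o @mpolyC n k) (fun v => ('X_v)%:P * 'X ^+ S v).
HB.instance Definition _ S := GRing.RMorphism.copy (scale_vars S)
  (mmap (polyC \o @mpolyC n k) (fun v => ('X_v)%:P * 'X ^+ S v)).

Lemma scale_varsX S v : scale_vars S 'X_v = ('X_v)%:P * 'X ^+ S v.
Proof. by rewrite /scale_vars mmapX mmap1U. Qed.

Lemma horner_scale_vars S p x :
  (scale_vars S p).[x] = p \mPo [tuple 'X_i * x ^+ S i | i < n].
Proof.
rewrite /scale_vars /mmap horner_sum comp_mpolyEX; apply: eq_bigr => mu _.
rewrite hornerCM mul_mpolyC; congr (_ *: _).
rewrite comp_mpolyX /mmap1 horner_prod; apply: eq_bigr => i _.
by rewrite tnth_mktuple !hornerE.
Qed.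

Definition zero_out S : n.-tuple R := [tuple if S i then 0 else 'X_i | i < n].
Definition free S p := p \mPo zero_out S = p.

Lemma scale_vars1 S p : (scale_vars S p).[1] = p.
Proof.
rewrite horner_scale_vars -[RHS]comp_mpoly_id; apply: eq_comp_mpoly => i.
by rewrite !tnth_mktuple expr1n mulr1.
Qed.

Lemma scale_vars_eq0 S p : (scale_vars S p == 0) = (p == 0).
Proof.
apply/eqP/eqP => [p0|->]; last by rewrite rmorph0.
by rewrite -(scale_vars1 S p) p0 horner0.
Qed.

Lemma free_size S p : (size (scale_vars S p) <= 1)%N -> free S p.
Proof.
move=> /size1_polyC pE.
apply: (etrans _ (scale_vars1 S p)).
rewrite [in RHS]pE hornerC -[RHS](hornerC _ 0) -pE horner_scale_vars.
by apply: eq_comp_mpoly => i; rewrite !tnth_mktuple; case: (S i); rewrite ?mulr0 ?mulr1.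
Qed.

Lemma size_scale_varsM S p q : p * q != 0 ->
  exists s t, [/\ size (scale_vars S p) = s.+1, size (scale_vars S q) = t.+1
    & size (scale_vars S (p * q)) = (s + t).+1].
Proof.
rewrite -(scale_vars_eq0 S) (rmorphM (scale_vars S)); exact: size_factors.
Qed.

Lemma free_factor S p q : p * q != 0 ->
  (size (scale_vars S (p * q)) <= 1)%N -> free S p.
Proof.
move=> /(size_scale_varsM S)[s [t [sp _ ->]]]; rewrite ltnS => st.
by apply: free_size; rewrite sp ltnS (leq_trans (leq_addr _ _) st).
Qed.

(** Degrees in [S] add up over a domain, so a product of degree at most 1 has a factor of degree
    0. *)
Lemma free_factor2 S p q : p * q != 0 ->
  (size (scale_vars S (p * q)) <= 2)%N -> free S p \/ free S q.
Proof.
move=> /(size_scale_varsM S)[s [t [sp sq ->]]]; rewrite ltnS => st.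
case: s sp st => [sp _|s _]; first by left; apply: free_size; rewrite sp.
case: t sq => [sq _|t _]; first by right; apply: free_size; rewrite sq.
by rewrite addnS.
Qed.

Lemma free_comp S p (F : n.-tuple R) : free S p ->
  (forall i, ~~ S i -> tnth F i = 'X_i) -> p \mPo F = p.
Proof.
move=> fp hF; rewrite -{1}fp comp_mpolyA; apply: etrans fp.
apply: eq_comp_mpoly => i; rewrite !tnth_mktuple.
case: ifPn => [_|Si]; first by rewrite comp_mpoly0.
by rewrite comp_mpolyXU -tnth_nth hF.
Qed.

Lemma freeU S T p : free S p -> free T p -> free (predU S T) p.
Proof.
move=> fS fT; have ST : p \mPo zero_out T = (p \mPo zero_out S) \mPo zero_out T by rewrite fS.
rewrite /free -{1}fS comp_mpolyA; apply: etrans fT; rewrite ST comp_mpolyA.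
apply: eq_comp_mpoly => i; rewrite !tnth_mktuple.
case: (boolP (S i)) => Si; first by rewrite !comp_mpoly0.
by rewrite !comp_mpolyXU -!tnth_nth !tnth_mktuple /= (negPf Si).
Qed.

Lemma free_has (I : eqType) (s : seq I) (S : I -> pred 'I_n) p :
  (forall i, i \in s -> free (S i) p) -> free [pred v | has (fun i => S i v) s] p.
Proof.
elim: s => [_|i s IHs hs].
  apply: etrans (comp_mpoly_id p); apply: eq_comp_mpoly => j.
  by rewrite !tnth_mktuple.
apply: (@freeU (S i) [pred v | has (fun i => S i v) s]).
  by apply: hs; rewrite mem_head.
by apply: IHs => j js; apply: hs; rewrite in_cons js orbT.
Qed.

End FreeVariables.

(** * The explicit inverse of the polar map *)

Section ClonedPattern.
Variables (m n : nat) (a b : 'I_m) (idx : 'I_m -> 'I_m -> 'I_n).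
Variable pos : 'I_n -> 'I_m * 'I_m.

Definition clone_pos (i j : 'I_m) := (i == j) && ((i == a) || (i == b)).

(** Keeps only what matters of the numbering of variables: [idx] identifies the positions (a, a) and
    (b, b) and no others, and [pos] chooses a position for each variable. *)
Record clone_pattern : Prop := ClonePattern {
  clone_neq : a != b;
  clone_idx : idx a a = idx b b;
  clone_inj : forall i j i' j', idx i j = idx i' j' ->
    (i, j) = (i', j') \/ clone_pos i j && clone_pos i' j';
  clone_posK : forall v, idx (pos v).1 (pos v).2 = v }.

Hypothesis hp : clone_pattern.
Let ab : a != b := clone_neq hp.
Lemma clone_size : (1 < m)%N.
Proof. exact: ord_neq_gt1 ab. Qed.

Lemma clone_posP i j : reflect (idx i j = idx a a) (clone_pos i j).
Proof.
apply: (iffP andP) => [[/eqP <- /orP[]/eqP ->]//|/(clone_inj hp)[[-> ->]|/andP[/andP[//]]]].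
  by rewrite -(clone_idx hp).
by rewrite !eqxx.
Qed.

Lemma idx_other i j i' j' : ~~ clone_pos i j ->
  (idx i' j' == idx i j) = (i' == i) && (j' == j).
Proof.
move=> cij; apply/eqP/andP=> [|[/eqP-> /eqP->]//].
by case/(clone_inj hp)=> [[-> ->]|/andP[_]]; rewrite ?eqxx // (negPf cij).
Qed.

Lemma idx_ind (P : 'I_n -> Prop) :
  P (idx a a) -> (forall i j, ~~ clone_pos i j -> P (idx i j)) -> forall v, P v.
Proof.
move=> Pa Pij v; rewrite -(clone_posK hp v).
by case: (boolP (clone_pos (pos v).1 (pos v).2)) => [/clone_posP->|/Pij].
Qed.

Section Coords.
Variable T : comNzRingType.
Implicit Types (Z C : 'M[T]_m) (y : 'I_n -> T).

Definition cloned Z := Z a a = Z b b.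
Definition coords Z v := Z (pos v).1 (pos v).2.

Lemma coordsE Z i j : cloned Z -> coords Z (idx i j) = Z i j.
Proof.
move=> cZ; have := clone_posK hp (idx i j); rewrite /coords.
case: (pos _) => i' j' /= /(clone_inj hp)[[-> ->]//|/andP[]].
case/andP=> /eqP<- ci /andP[/eqP<- cj].
by case/orP: ci => /eqP->; case/orP: cj => /eqP->.
Qed.

Lemma coordsZ x Z v : coords (x *: Z) v = x * coords Z v.
Proof. exact: mxE. Qed.

(** The transpose of filling a cloned matrix from its coordinates ([sum_coords]); on the cofactor
    matrix it yields the gradient. *)
Definition fiber_sum Z v := \sum_i \sum_j (idx i j == v)%:R * Z i j.

Lemma fiber_sum_other Z i j : ~~ clone_pos i j -> fiber_sum Z (idx i j) = Z i j.
Proof.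
move=> cij; rewrite /fiber_sum (bigD1 i) //= (bigD1 j) //= eqxx mul1r.
rewrite !big1 ?addr0 // => [i' /negPf ii'|j' /negPf jj']; first rewrite big1 // => j' _.
  by rewrite idx_other // ii' mul0r.
by rewrite idx_other // jj' andbF mul0r.
Qed.

Lemma fiber_sum_clone Z : fiber_sum Z (idx a a) = Z a a + Z b b.
Proof.
have E i j : (idx i j == idx a a) = clone_pos i j.
  by apply/eqP/idP => [/clone_posP|/clone_posP].
have row i : i \in [:: a; b] -> \sum_j (idx i j == idx a a)%:R * Z i j = Z i i.
  rewrite !inE => iab; rewrite (bigD1 i) //= E /clone_pos eqxx iab mul1r.
  by rewrite big1 ?addr0 // => j /negPf ji; rewrite E /clone_pos eq_sym ji mul0r.
rewrite /fiber_sum (bigD1 a) //= [X in _ + X](bigD1 b) 1?eq_sym //= !row ?inE ?eqxx ?orbT //.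
rewrite [X in _ + (_ + X)]big1 ?addr0 // => i /andP[/negPf ia /negPf ib].
by rewrite big1 // => j _; rewrite E /clone_pos ia ib andbF mul0r.
Qed.

Lemma fiber_sumZ x Z v : fiber_sum (x *: Z) v = x * fiber_sum Z v.
Proof.
rewrite /fiber_sum mulr_sumr; apply: eq_bigr => i _; rewrite mulr_sumr.
by apply: eq_bigr => j _; rewrite mxE mulrCA.
Qed.

Lemma sum_coords Z C : cloned Z ->
  \sum_v coords Z v * fiber_sum C v = \sum_i \sum_j Z i j * C i j.
Proof.
move=> cZ; under eq_bigr => v _ do rewrite mulr_sumr.
rewrite exchange_big; apply: eq_bigr => i _ /=.
under eq_bigr => v _ do rewrite mulr_sumr.
rewrite exchange_big; apply: eq_bigr => j _ /=.
rewrite (bigD1 (idx i j)) //= eqxx mul1r coordsE // big1 ?addr0 // => v.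
by rewrite eq_sym => /negPf->; rewrite mul0r mulr0.
Qed.

(* [polar_rep y] is a matrix Y with [fiber_sum Y = 2 y], i.e. with prescribed *)
(* polar image 2 y; the entries at the two cloned positions are only          *)
(* determined up to a multiple of [delta_mx a a - delta_mx b b].              *)
Definition polar_rep y : 'M[T]_m :=
  \matrix_(i, j) (y (idx i j) *+ (if clone_pos i j then 1 else 2)).

Lemma polar_rep_fiber_sum C : polar_rep (fiber_sum C) =
  2%:R *: C + (C b b - C a a) *: (delta_mx a a - delta_mx b b).
Proof.
apply/matrixP=> i j; rewrite !mxE; case: (boolP (clone_pos i j)) => cij.
  rewrite (clone_posP _ _ cij) fiber_sum_clone; case/andP: cij => /eqP <-.
  case/orP=> /eqP->; rewrite !eqxx ?(negPf ab) ?[b == a]eq_sym ?(negPf ab) /=; ring.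
rewrite fiber_sum_other //.
have nd l : (l == a) || (l == b) -> (i == l) && (j == l) = false.
  move=> lab; apply: contraNF cij => /andP[/eqP-> /eqP->].
  by rewrite /clone_pos eqxx lab.
by rewrite !nd ?eqxx ?orbT // subrr mulr0 addr0 mulr_natl.
Qed.

Definition inverse_matrix y : 'M[T]_m := (\adj (balance a b (polar_rep y)))^T.

Lemma inverse_matrix_cloned y : cloned (inverse_matrix y).
Proof.
rewrite /cloned !mxE; apply/eqP; rewrite -subr_eq0.
have := diag_gap_balance (polar_rep y) ab; rewrite /diag_gap !mxE => ->.
by rewrite eqxx.
Qed.

(** Moving Y by [C a a - C b b] along the gap direction gives 2 C, whose [diag_gap] is 0; hence this
    difference is the solution of the linear equation that [balance] solves. *)
Lemma balance_polar_rep C : diag_gap a b C = 0 ->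
  balance a b (polar_rep (fiber_sum C)) =
  (corner_det a b (polar_rep (fiber_sum C)) *+ 4) *: C.
Proof.
move=> gC; set Y := polar_rep _.
have YE : Y + (C a a - C b b) *: (delta_mx a a - delta_mx b b) = 2%:R *: C.
  by rewrite /Y polar_rep_fiber_sum -[C b b - _]opprB scaleNr subrK.
have := diag_gapD Y (C a a - C b b) ab; rewrite YE diag_gapZ gC mulr0 => /esym/eqP.
rewrite subr_eq0 /balance => /eqP->.
rewrite -mulrnAr mulrC -scalerA -scalerDr YE scalerA.
by congr (_ *: C); ring.
Qed.

(** The correction along the gap direction has zero fiber sum. One factor 2 comes from [balance],
    the other from [polar_rep]. *)
Lemma fiber_sum_balance y v :
  fiber_sum (balance a b (polar_rep y)) v =
  (corner_det a b (polar_rep y) *+ 4) * y v.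
Proof.
elim/idx_ind: v => [|i j cij].
  rewrite fiber_sum_clone !mxE !eqxx (negPf ab) [b == a]eq_sym (negPf ab) /=.
  have /clone_posP cb := esym (clone_idx hp).
  have /clone_posP ca := erefl (idx a a).
  by rewrite ca cb -(clone_idx hp); ring.
rewrite fiber_sum_other // !mxE (negPf cij).
have nd l : (l == a) || (l == b) -> (i == l) && (j == l) = false.
  move=> lab; apply: contraNF cij => /andP[/eqP-> /eqP->].
  by rewrite /clone_pos eqxx lab.
rewrite !nd ?eqxx ?orbT // subrr mulr0 addr0; ring.
Qed.

Lemma polar_rep1 : polar_rep (fiber_sum 1%:M) = 2%:M.
Proof.
rewrite polar_rep_fiber_sum !mxE !eqxx subrr scale0r addr0.
by rewrite scale_scalar_mx mulr1.
Qed.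

Lemma corner_det_polar_rep1 :
  corner_det a b (polar_rep (fiber_sum 1%:M)) = 2%:R ^+ m.-2.
Proof.
rewrite polar_rep1 -scalemx1 corner_detZ // /corner_det.
have -> : unit_rows a b 1%:M = 1%:M :> 'M[T]_m.
  by apply/matrixP=> i j; rewrite !mxE if_same.
by rewrite det1 mulr1.
Qed.

End Coords.

Lemma inverse_matrix_polar (T : idomainType) (X : 'M[T]_m) :
    cloned X -> \det X != 0 ->
  let y := fiber_sum (\adj X)^T in
  inverse_matrix y =
  ((corner_det a b (polar_rep y) *+ 4) ^+ m.-1 * \det X ^+ m.-2) *: X.
Proof.
move=> cX dX y; have adjadj := adj_adj clone_size dX.
have gC : diag_gap a b (\adj X)^T = 0.
  rewrite /diag_gap -trmx_adj adjadj; move: cX; rewrite /cloned !mxE => ->.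
  by rewrite subrr.
rewrite /inverse_matrix balance_polar_rep // adjZ -trmx_adj adjadj.
by rewrite linearZ /= trmxK scalerA.
Qed.

Lemma polar_inverse_matrix (T : idomainType) (y : 'I_n -> T) v :
  let B := balance a b (polar_rep y) in \det B != 0 ->
  fiber_sum (\adj (inverse_matrix y))^T v =
  (\det B ^+ m.-2 * (corner_det a b (polar_rep y) *+ 4)) * y v.
Proof.
move=> B dB; rewrite /inverse_matrix -trmx_adj trmxK (adj_adj clone_size dB).
by rewrite fiber_sumZ fiber_sum_balance mulrA.
Qed.

End ClonedPattern.

(** * Compatibility of the construction with ring morphisms (substitution and evaluation) *)

Section ClonedMorphism.
Variables (m n : nat) (a b : 'I_m) (idx : 'I_m -> 'I_m -> 'I_n).
Variables (T U : comNzRingType) (phi : {rmorphism T -> U}).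

Lemma map_unit_rows (Z : 'M[T]_m) i j :
  map_mx phi (unit_rows i j Z) = unit_rows i j (map_mx phi Z).
Proof.
by apply/matrixP=> p q; rewrite !mxE; case: ifP => //; rewrite rmorph_nat.
Qed.

Lemma map_corner_det (Z : 'M[T]_m) :
  phi (corner_det a b Z) = corner_det a b (map_mx phi Z).
Proof. by rewrite /corner_det -det_map_mx map_unit_rows. Qed.

Lemma map_balance (Z : 'M[T]_m) :
  map_mx phi (balance a b Z) = balance a b (map_mx phi Z).
Proof.
rewrite /balance map_mxD !map_mxZ map_mxB !map_delta_mx rmorphMn map_corner_det.
by rewrite /diag_gap rmorphB -map_mx_adj !mxE.
Qed.

Lemma map_polar_rep y y' : (forall v, phi (y v) = y' v) ->
  map_mx phi (polar_rep a b idx y) = polar_rep a b idx y'.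
Proof. by move=> yy'; apply/matrixP=> i j; rewrite !mxE rmorphMn yy'. Qed.

Lemma map_inverse_matrix y y' : (forall v, phi (y v) = y' v) ->
  map_mx phi (inverse_matrix a b idx y) = inverse_matrix a b idx y'.
Proof.
by move=> yy'; rewrite -map_trmx map_mx_adj map_balance (map_polar_rep yy').
Qed.

Lemma map_fiber_sum (Z : 'M[T]_m) v :
  phi (fiber_sum idx Z v) = fiber_sum idx (map_mx phi Z) v.
Proof.
rewrite /fiber_sum rmorph_sum; apply: eq_bigr => i _.
rewrite rmorph_sum; apply: eq_bigr => j _.
by rewrite rmorphM rmorph_nat mxE.
Qed.

End ClonedMorphism.

(** * The two composites of the polar map with its inverse *)

Section ClonedDeterminant.
Variables (k : fieldType) (m n : nat) (a b : 'I_m).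
Variables (idx : 'I_m -> 'I_m -> 'I_n) (pos : 'I_n -> 'I_m * 'I_m).
Hypothesis hk : [pchar k] =i pred0.
Hypothesis hp : clone_pattern a b idx pos.
Local Notation R := {mpoly k[n]}.
Let ab : a != b := clone_neq hp.

Definition cloned_mx : 'M[R]_m := \matrix_(i, j) 'X_(idx i j).
Local Notation X := cloned_mx.
Definition cloned_det : R := \det X.
Local Notation f := cloned_det.

Lemma cloned_mx_cloned : cloned a b X.
Proof. by rewrite /cloned !mxE (clone_idx hp). Qed.

Lemma mderiv_cloned_det v : f^`M(v) = fiber_sum idx (\adj X)^T v.
Proof.
rewrite mderiv_det; apply: eq_bigr => i _; apply: eq_bigr => j _.
by rewrite !mxE mderivXU.
Qed.

Lemma cloned_mx_point (T : comNzRingType) (Z : 'M[T]_m)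
    (phi : {rmorphism R -> T}) : cloned a b Z ->
  (forall v, phi 'X_v = coords pos Z v) -> map_mx phi X = Z.
Proof.
move=> cZ hphi; apply/matrixP=> i j; rewrite !mxE hphi.
exact: (coordsE hp).
Qed.

Lemma coords_cloned_mx v : coords pos X v = 'X_v.
Proof. by rewrite /coords mxE (clone_posK hp). Qed.

Definition id_point : 'I_n -> k := coords pos 1%:M.

Lemma cloned_mx_id : map_mx (meval id_point) X = 1%:M.
Proof.
by apply: cloned_mx_point => [|v]; [rewrite /cloned !mxE !eqxx | exact: mevalXU].
Qed.

Lemma cloned_det_id : f.@[id_point] = 1.
Proof. by rewrite -det_map_mx cloned_mx_id det1. Qed.

Lemma cloned_det_neq0 : f != 0.
Proof.
by apply: contra_eq_neq cloned_det_id => ->; rewrite meval0 eq_sym oner_eq0.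
Qed.

Lemma gradient_id v : f^`M(v).@[id_point] = fiber_sum idx 1%:M v.
Proof.
rewrite mderiv_cloned_det map_fiber_sum -map_trmx map_mx_adj cloned_mx_id adj1.
by rewrite trmx1.
Qed.

Let nat_neq0 p : (p.+1%:R : k) != 0.
Proof. by rewrite ((pcharf0P k).1 hk). Qed.

Let corner_neq0 p : (2%:R ^+ p *+ 4 : k) != 0.
Proof. by rewrite -(mulr_natr (2%:R ^+ p) 4) mulf_neq0 ?expf_neq0 ?nat_neq0. Qed.

Local Notation F := (gradient f).

Definition inverse_map : n.-tuple R :=
  [tuple coords pos (inverse_matrix a b idx (fun i => 'X_i : R)) v | v < n].
Local Notation G := inverse_map.

Lemma polar_rep_gradient : polar_rep a b idx (fun v => f^`M(v)) =
  polar_rep a b idx (fiber_sum idx (\adj X)^T).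
Proof. by apply/matrixP=> i j; rewrite !mxE mderiv_cloned_det. Qed.

Definition left_factor : R :=
  (corner_det a b (polar_rep a b idx (fun v => f^`M(v))) *+ 4) ^+ m.-1
  * f ^+ m.-2.

Lemma inverse_map_gradient v : tnth G v \mPo F = left_factor * 'X_v.
Proof.
have hF i : 'X_i \mPo F = fiber_sum idx (\adj X)^T i.
  by rewrite comp_mpolyXU -tnth_nth tnth_mktuple mderiv_cloned_det.
have mE := map_inverse_matrix a b idx hF.
have -> : tnth G v \mPo F =
    coords pos (inverse_matrix a b idx (fiber_sum idx (\adj X)^T)) v.
  by rewrite tnth_mktuple -mE [RHS]mxE.
rewrite (inverse_matrix_polar hp cloned_mx_cloned cloned_det_neq0) coordsZ.
rewrite coords_cloned_mx /left_factor -polar_rep_gradient.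
reflexivity.
Qed.

Lemma left_factor_neq0 : left_factor != 0.
Proof.
apply: contraTneq isT => h0.
have : left_factor.@[id_point] != 0; last by rewrite h0 meval0 eqxx.
rewrite mevalM !rmorphXn /= cloned_det_id expr1n mulr1 expf_neq0 //.
rewrite rmorphMn map_corner_det (map_polar_rep a b idx gradient_id).
by rewrite (corner_det_polar_rep1 hp).
Qed.

Local Notation B := (balance a b (polar_rep a b idx (fun i => 'X_i : R))).

Definition right_factor : R :=
  \det B ^+ m.-2 * (corner_det a b (polar_rep a b idx (fun i => 'X_i : R)) *+ 4).

Let grad_point (v : 'I_n) : k := fiber_sum idx 1%:M v.

Lemma corner_det_grad_point :
  (corner_det a b (polar_rep a b idx (fun i => 'X_i : R)) *+ 4).@[grad_point] != 0.
Proof.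
rewrite mevalMn map_corner_det (map_polar_rep a b idx (y' := grad_point)) => [|v];
  last exact: mevalXU.
by rewrite (corner_det_polar_rep1 hp).
Qed.

(** At the polar image of the identity matrix, [balance] returns a nonzero multiple of the
    identity. *)
Lemma det_balance_neq0 : \det B != 0.
Proof.
apply: contraTneq isT => h0.
have : (\det B).@[grad_point] != 0; last by rewrite h0 meval0 eqxx.
rewrite -det_map_mx map_balance (map_polar_rep a b idx (y' := grad_point)) => [|v];
  last exact: mevalXU.
rewrite (balance_polar_rep hp); last by rewrite /diag_gap adj1 !mxE !eqxx subrr.
by rewrite detZ det1 mulr1 expf_neq0 // (corner_det_polar_rep1 hp).
Qed.

Lemma right_factor_neq0 : right_factor != 0.
Proof.
rewrite mulf_neq0 ?expf_neq0 ?det_balance_neq0 //.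
by apply: contraNneq corner_det_grad_point => ->; rewrite meval0.
Qed.

Lemma gradient_inverse_map v : tnth F v \mPo G = right_factor * 'X_v.
Proof.
rewrite tnth_mktuple mderiv_cloned_det map_fiber_sum -map_trmx map_mx_adj.
rewrite (cloned_mx_point (Z := inverse_matrix a b idx (fun i => 'X_i : R))).
- exact: (polar_inverse_matrix hp _ det_balance_neq0).
- exact: (inverse_matrix_cloned hp).
by move=> i; rewrite /= comp_mpolyXU -tnth_nth tnth_mktuple.
Qed.

End ClonedDeterminant.

(** * Rank of linear syzygies *)

Section LinearRank.
Variables (k : fieldType) (n : nat).
Local Notation R := {mpoly k[n]}.
Local Notation tofracmx := (map_mx (@tofrac R)).

(** Lower semicontinuity of the rank: constant matrices P and Q reduce the evaluated matrix to an
    identity of size its rank, so P M Q has a determinant that evaluates to 1 and is therefore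
    nonzero. *)
Lemma rank_meval p q (M : 'M[R]_(p, q)) (x : 'I_n -> k) :
  (\rank (map_mx (meval x) M) <= \rank (tofracmx M))%N.
Proof.
set N := map_mx _ M; pose P := pinvmx (col_base N); pose Q := pinvmx (row_base N).
have PNQ : P *m N *m Q = 1%:M.
  rewrite -[N in P *m N]mulmx_base mulmxA mulVpmx ?col_base_full // mul1mx.
  exact/mulmxVp/row_base_free.
pose L r s (A : 'M[k]_(r, s)) : 'M[R]_(r, s) := map_mx (@mpolyC n k) A.
have LK r s (A : 'M[k]_(r, s)) : map_mx (meval x) (L r s A) = A.
  by apply/matrixP=> i j; rewrite !mxE mevalC.
pose M' := L _ _ P *m M *m L _ _ Q.
have dM' : \det M' != 0.
  apply: contra_eq_neq (det1 k (\rank N)) => dM0.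
  by rewrite -PNQ -(LK _ _ P) -(LK _ _ Q) -!map_mxM det_map_mx dM0 rmorph0 eq_sym oner_eq0.
have : row_free (tofracmx M').
  by rewrite row_free_unit unitmxE det_map_mx unitfE tofrac_eq0.
rewrite /row_free => /eqP {1}<-; rewrite !map_mxM.
exact: leq_trans (mxrankM_maxl _ _) (mxrankM_maxr _ _).
Qed.

(** Every matrix of syzygies is killed on the left by the nonzero row of generators, so its rank is
    at most q - 1. If M attains this bound, adjoining any further syzygy cannot raise the rank, so M
    spans them all. *)
Lemma linear_rank_max q (g : q.-tuple R) c (M : 'M[R]_(q, c)) :
    (exists i, tnth g i != 0) -> (forall j, linear_syzygy g (col j M)) ->
    (q.-1 <= \rank (tofracmx M))%N ->
  linear_syzygies_have_rank g q.-1.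
Proof.
move=> [i0 gi0] Msyz rM; pose w : 'rV[R]_q := \row_i tnth g i.
have w0 : tofracmx w != 0.
  apply: contraNneq gi0 => /rowP/(_ i0)/eqP; rewrite !mxE.
  by rewrite tofrac_eq0.
have syzP d (A : 'M[R]_(q, d)) : (forall j, linear_syzygy g (col j A)) ->
    tofracmx w *m tofracmx A = 0.
  move=> As; rewrite -map_mxM; have -> : w *m A = 0; last by rewrite map_mx0.
  apply/rowP=> j; rewrite !mxE; have [_ sj] := As j; apply: etrans sj.
  by apply: eq_bigr => i _; rewrite !mxE mulrC.
have rank_le d (N : 'M[{fraction R}]_(q, d)) : tofracmx w *m N = 0 -> (\rank N <= q.-1)%N.
  move/sub_kermxP/mxrankS; rewrite rank_rV w0 mxrank_ker => h.
  by rewrite -subn1 leq_subRL ?(leq_trans h) ?leq_subr // addnC -leq_subRL // ltnW // -subn_gt0.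
have rME : \rank (tofracmx M) = q.-1.
  by apply/eqP; rewrite eqn_leq rM rank_le // syzP.
exists c, M; split=> // s ss.
have sM : ((tofracmx s)^T <= (tofracmx M)^T)%MS.
  have sub : ((tofracmx M)^T <= (tofracmx M)^T + (tofracmx s)^T)%MS by exact: addsmxSl.
  apply: (submx_trans (addsmxSr (tofracmx M)^T _)).
  rewrite -(mxrank_leqif_sup sub) mxrank_tr rME eqn_leq; apply/andP; split.
    by rewrite -rME -mxrank_tr; exact: mxrankS.
  rewrite addsmxE -tr_row_mx mxrank_tr rank_le // mul_mx_row.
  rewrite !syzP ?row_mx0 // => j; suff -> : col j s = s by [].
  by apply/colP=> i; rewrite !mxE (ord1 j).
case/submxP: sM => D sD; exists D^T.
by rewrite -[LHS]trmxK sD trmx_mul trmxK.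
Qed.

Lemma linear_rank_point (g : n.-tuple R) (M : 'M[R]_n) (x w : 'I_n -> k) :
    (exists i, tnth g i != 0) -> (forall j, linear_syzygy g (col j M)) ->
    (forall u : 'rV[k]_n, u *m map_mx (meval x) M = 0 ->
       exists t, forall i, u 0 i = t * w i) ->
  linear_syzygies_have_rank g n.-1.
Proof.
move=> g0 Msyz ker1; apply: (linear_rank_max g0 Msyz).
apply: leq_trans (rank_meval M x); set N := map_mx _ M.
have : (\rank (kermx N) <= 1)%N.
  apply: leq_trans (rank_leq_row (\row_i w i)); apply: mxrankS.
  apply/row_subP=> i; have /ker1[t ut] : row i (kermx N) *m N = 0.
    by rewrite -row_mul mulmx_ker row0.
  have -> : row i (kermx N) = t *: \row_i w i.
    by apply/rowP=> j; rewrite ut !mxE.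
  exact: scalemx_sub.
by rewrite mxrank_ker leq_subLR addn1 -subn1 leq_subLR add1n.
Qed.

End LinearRank.

(** * Homaloidness and the Hessian *)

Section ClonedPolar.
Variables (k : fieldType) (m n : nat) (a b : 'I_m).
Variables (idx : 'I_m -> 'I_m -> 'I_n) (pos : 'I_n -> 'I_m * 'I_m).
Hypothesis hk : [pchar k] =i pred0.
Hypothesis hp : clone_pattern a b idx pos.
Local Notation R := {mpoly k[n]}.
Local Notation X := (cloned_mx k idx).
Local Notation f := (cloned_det k idx).
Local Notation F := (gradient f).
Local Notation G := (inverse_map k a b idx pos).
Let ab : a != b := clone_neq hp.
Let m_gt1 : (1 < m)%N := clone_size hp.

Lemma dhomog_nat (c : nat) : c%:R \is [in k[n], 0.-homog].
Proof. by apply: rpredMn; exact: dhomog1. Qed.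

Lemma dhomog_adj (Z : 'M[R]_m) d i j : (forall i j, Z i j \is d.-homog) ->
  \adj Z i j \is (m.-1 * d)%N.-homog.
Proof.
move=> hZ; rewrite mxE /cofactor rpredMsign.
have -> : (m.-1 * d = \sum_(i < m.-1) d)%N by rewrite sum_nat_const card_ord.
by apply: dhomog_det => p q; rewrite !mxE.
Qed.

Lemma dhomog_fiber_sum (Z : 'M[R]_m) d v : (forall i j, Z i j \is d.-homog) ->
  fiber_sum idx Z v \is d.-homog.
Proof.
move=> hZ; apply: rpred_sum => i _; apply: rpred_sum => j _.
by rewrite mulr_natl rpredMn.
Qed.

Lemma dhomog_cloned_mx i j : X i j \is 1.-homog.
Proof. by rewrite mxE dhomogX; apply/eqP/mdeg1. Qed.

Lemma dhomog_gradient v : f^`M(v) \is m.-1.-homog.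
Proof.
rewrite mderiv_cloned_det; apply: dhomog_fiber_sum => i j.
rewrite mxE -[m.-1]muln1; apply: dhomog_adj; exact: dhomog_cloned_mx.
Qed.

Lemma dhomog_polar_rep i j :
  polar_rep a b idx (fun v => 'X_v : R) i j \is 1.-homog.
Proof. by rewrite mxE; apply: rpredMn; rewrite dhomogX; apply/eqP/mdeg1. Qed.

Lemma dhomog_corner_det :
  corner_det a b (polar_rep a b idx (fun v => 'X_v : R)) \is m.-2.-homog.
Proof.
pose d i := if (i == a) || (i == b) then 0%N else 1%N.
have -> : m.-2 = (\sum_i d i)%N.
  under eq_bigr => i _ do rewrite /d -if_neg.
  by rewrite -big_mkcond sum1_card card_off_pair.
apply: dhomog_det => i j; rewrite mxE /d; case: ifP => _; first exact: dhomog_nat.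
exact: dhomog_polar_rep.
Qed.

Lemma dhomog_balance i j :
  balance a b (polar_rep a b idx (fun v => 'X_v : R)) i j \is m.-1.-homog.
Proof.
set Y := polar_rep _ _ _ _.
have gapY : diag_gap a b Y \is m.-1.-homog.
  by rewrite -[m.-1]muln1; apply: rpredB; apply: dhomog_adj; exact: dhomog_polar_rep.
rewrite balanceE; apply: rpredD; last first.
  by rewrite mulrBr !mulr_natr; apply: rpredB; apply: rpredMn.
have -> : m.-1 = (m.-2 + 1)%N by move: m_gt1; case: (m) => [|[|p]] //=; rewrite addn1.
apply: dhomogM; last exact: dhomog_polar_rep.
by apply: rpredMn; exact: dhomog_corner_det.
Qed.

Lemma dhomog_inverse_map v : tnth G v \is (m.-1 * m.-1)%N.-homog.
Proof.
by rewrite tnth_mktuple /coords mxE; apply: dhomog_adj => i j; exact: dhomog_balance.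
Qed.

Lemma mpolyXU_neq0 (v : 'I_n) : ('X_v : R) != 0.
Proof.
by apply: contra_eq_neq (mevalXU (fun=> 1 : k) v) => ->; rewrite meval0 eq_sym oner_eq0.
Qed.

(** A zero partial would stay zero after composition with the inverse, whereas the composite is a
    nonzero multiple of [X_v]. *)
Lemma gradient_neq0 v : f^`M(v) != 0.
Proof.
have : right_factor k a b idx * 'X_v != 0.
  by rewrite mulf_neq0 ?(right_factor_neq0 hk hp) ?mpolyXU_neq0.
rewrite -(gradient_inverse_map hk hp) tnth_mktuple.
by apply: contraNneq => ->; rewrite comp_mpoly0.
Qed.

Lemma inverse_map_neq0 v : tnth G v != 0.
Proof.
have : left_factor k a b idx * 'X_v != 0.
  by rewrite mulf_neq0 ?(left_factor_neq0 hk hp) ?mpolyXU_neq0.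
rewrite -(inverse_map_gradient k hp).
by apply: contraNneq => ->; rewrite comp_mpoly0.
Qed.

Lemma left_inverse_factor (P Q : n.-tuple R) (d e : nat) (h : R) :
    (forall v, tnth P v \is d.-homog) -> (forall v, tnth Q v \is e.-homog) ->
    h != 0 -> (forall v, tnth P v \mPo Q = h * 'X_v) ->
  left_inverse_map P Q.
Proof.
move=> hP hQ h0 PQ.
have PQE v : tnth (comp_map P Q) v = h * 'X_v by rewrite tnth_mktuple.
split; last by move=> i j; rewrite !PQE !tnth_mktuple mulrAC.
split; first by exists (d * e)%N => i; rewrite tnth_mktuple; exact: dhomog_comp.
by exists (idx a a); rewrite PQE mulf_neq0 ?mpolyXU_neq0.
Qed.

Lemma cloned_det_homaloidal : homaloidal f.
Proof.
have hF v : tnth F v \is m.-1.-homog by rewrite tnth_mktuple dhomog_gradient.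
split; first split.
- by exists m.-1.
- by exists (idx a a); rewrite tnth_mktuple gradient_neq0.
exists G; split.
- split; first by exists (m.-1 * m.-1)%N; exact: dhomog_inverse_map.
  by exists (idx a a); exact: inverse_map_neq0.
- exact: left_inverse_factor dhomog_inverse_map hF (left_factor_neq0 hk hp)
    (inverse_map_gradient k hp).
exact: left_inverse_factor hF dhomog_inverse_map (right_factor_neq0 hk hp)
    (gradient_inverse_map hk hp).
Qed.

(* A kernel vector v of the Hessian is a derivation killing F, hence killing  *)
(* G o F = h X; this forces v to be proportional to X, and Euler's identity   *)
(* on F shows that the factor of proportionality vanishes.                    *)
Lemma cloned_det_hessian : hessian_det f != 0.
Proof.
apply/negP => /det0P[v v0 vH]; pose D := dirderiv (fun i => v 0 i).
have DF i : D f^`M(i) = 0.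
  transitivity ((v *m hessian f) 0 i); last by rewrite vH mxE.
  rewrite mxE; apply: eq_bigr => j _; rewrite [hessian f _ _]mxE.
  by rewrite mderiv_comm.
set h := left_factor k a b idx; have h0 : h != 0 := left_factor_neq0 hk hp.
have hv i : h * v 0 i = - (D h * 'X_i).
  apply/eqP; rewrite -subr_eq0 opprK addrC -(dirderivX (fun i => v 0 i) i).
  rewrite -dirderiv_mulr -(inverse_map_gradient k hp).
  apply/eqP/dirderiv_comp0 => j; rewrite tnth_mktuple; exact: DF.
have Dh : D h = 0.
  pose g := f^`M(idx a a); have g0 : g != 0 := gradient_neq0 _.
  have : h * D g = - (D h * (m.-1%:R *: g)).
    rewrite -(euler_identity (dhomog_gradient _)) /D /dirderiv !mulr_sumr -sumrN.
    by apply: eq_bigr => i _; rewrite mulrA hv mulNr mulrA.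
  rewrite DF mulr0 => /esym/eqP; rewrite oppr_eq0 mulf_eq0 => /orP[/eqP //|].
  rewrite mscalerI (negPf g0) orbF ((pcharf0P k).1 hk).
  by move: m_gt1; case: (m) => [|[]].
case/negP: v0; apply/eqP/rowP=> i; rewrite mxE; apply: (mulfI h0).
by rewrite hv Dh mul0r mulr0 oppr0.
Qed.

(** Composed with the inverse map, a redundant generator would make [X_i] a combination of the other
    variables; evaluation at the i-th unit vector gives 1 = 0. *)
Lemma cloned_gradient_minimal : minimally_generates F (gradient_ideal f).
Proof.
split=> [p|i [c /(congr1 (comp_mpoly G))]]; first by split.
rewrite (gradient_inverse_map hk hp) linear_sum.
set h := right_factor k a b idx; have h0 : h != 0 := right_factor_neq0 hk hp.
under eq_bigr => j _ do
  rewrite rmorphM /= (gradient_inverse_map hk hp) -/h mulrCA.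
rewrite -mulr_sumr => /(mulfI h0)/(congr1 (meval (fun l => (l == i)%:R))).
rewrite mevalXU eqxx linear_sum big1 => [/eqP|j /negPf ji]; first by rewrite oner_eq0.
by rewrite /= mevalM mevalXU ji mulr0.
Qed.

End ClonedPolar.

(** * Linear syzygies of the gradient *)

Lemma mul_deltaE (R : comNzRingType) m (Z : 'M[R]_m)
    (i j p q : 'I_m) :
  (delta_mx i j *m Z) p q = (p == i)%:R * Z j q.
Proof.
rewrite mxE (bigD1 j) //= mxE eqxx andbT big1 ?addr0 // => l /negPf lj.
by rewrite mxE lj andbF mul0r.
Qed.

Lemma mul_mx_deltaE (R : comNzRingType) m (Z : 'M[R]_m)
    (i j p q : 'I_m) :
  (Z *m delta_mx i j) p q = Z p i * (q == j)%:R.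
Proof.
rewrite mxE (bigD1 i) //= mxE eqxx big1 ?addr0 // => l /negPf lj.
by rewrite mxE lj mulr0.
Qed.

Section ClonedFields.
Variables (m n : nat) (a b : 'I_m).
Variables (idx : 'I_m -> 'I_m -> 'I_n) (pos : 'I_n -> 'I_m * 'I_m).
Hypothesis hp : clone_pattern a b idx pos.
Let ab : a != b := clone_neq hp.

Definition fiber_mx (T : comNzRingType) v : 'M[T]_m :=
  \matrix_(i, j) (idx i j == v)%:R.

Lemma fiber_mx_other (T : comNzRingType) i j : ~~ clone_pos a b i j ->
  fiber_mx T (idx i j) = delta_mx i j.
Proof. by move=> cij; apply/matrixP=> p q; rewrite !mxE (idx_other hp). Qed.

(* Linear vector fields X |-> A X + X B tangent to the space of cloned        *)
(* matrices and preserving the determinant; at X = 1 they span the cloned     *)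
(* matrices of trace 0.                                                       *)
Lemma cloned_field (k : fieldType) (T : comNzRingType) (phi : {rmorphism k -> T})
    (X : 'M[T]_m) v : [pchar k] =i pred0 -> cloned a b X ->
  exists A B : 'M[k]_m, exists2 x : k, x != 0 &
    [/\ \tr A + \tr B = 0,
        cloned a b (map_mx phi A *m X + X *m map_mx phi B)
      & A + B = x *: fiber_mx k v - (\tr (fiber_mx k v))%:M].
Proof.
move=> /pcharf0P k0 cX; set U := fiber_mx k v; set t := \tr U.
have [i [j vE]] : exists i j, v = idx i j.
  by exists (pos v).1, (pos v).2; rewrite (clone_posK hp).
have UC : U a a = U b b by rewrite !mxE (clone_idx hp).
(* For a variable on the diagonal, A is diagonal of trace 0 with equal entries at [a] and [b], so A
   X stays cloned. *)
have [ij|ij] := eqVneq i j.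
  have Ud p q : p != q -> U p q = 0.
    move=> pq; rewrite mxE vE -ij; case: eqP => // /(clone_inj hp)[[pi qi]|/andP[]].
      by rewrite pi qi eqxx in pq.
    by rewrite /clone_pos (negPf pq).
  exists (m%:R *: U - t%:M), 0, m%:R.
    by rewrite k0 -lt0n (ltn_trans _ (clone_size hp)).
  split; last by rewrite addr0.
    by rewrite linear0 addr0 linearB linearZ /= mxtrace_scalar mulr_natl subrr.
  rewrite map_mx0 mulmx0 addr0 /cloned.
  have EU p q : (m%:R *: U - t%:M) p q = m%:R * U p q - t *+ (p == q).
    by rewrite !mxE.
  have E p q : (map_mx phi (m%:R *: U - t%:M) *m X) p q = phi (m%:R * U p p - t) * X p q.
    rewrite mxE (bigD1 p) //= big1 ?addr0 => [|l lp]; first by rewrite mxE EU eqxx.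
    by rewrite mxE EU [p == l]eq_sym (negPf lp) Ud ?mulr0 ?subr0 ?rmorph0 ?mul0r // eq_sym.
  by rewrite !E UC cX.
have UE : U = delta_mx i j by rewrite /U vE fiber_mx_other // /clone_pos (negPf ij).
have t0 : t = 0.
  rewrite /t UE /mxtrace big1 // => l _; rewrite mxE.
  by case: eqP => // ->; rewrite (negPf ij).
(* Off the diagonal U = E_ij. If i is neither [a] nor [b], then U X is zero outside row i and misses
   both cloned positions; likewise X U and column j. *)
rewrite t0; case: (boolP (i \in [:: a; b])) => [iab|]; last first.
  rewrite !inE negb_or => /andP[/negPf ia /negPf ib].
  exists U, 0, 1; rewrite ?oner_eq0 //; split.
  - by rewrite linear0 addr0.
  - rewrite map_mx0 mulmx0 addr0 UE map_delta_mx /cloned !mul_deltaE.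
    by rewrite ![_ == i]eq_sym ia ib !mul0r.
  by rewrite scale1r raddf0 subr0 addr0.
case: (boolP (j \in [:: a; b])) => [jab|]; last first.
  rewrite !inE negb_or => /andP[/negPf ja /negPf jb].
  exists 0, U, 1; rewrite ?oner_eq0 //; split.
  - by rewrite linear0 add0r.
  - rewrite map_mx0 mul0mx add0r UE map_delta_mx /cloned !mul_mx_deltaE.
    by rewrite ![_ == j]eq_sym ja jb !mulr0.
  by rewrite scale1r raddf0 subr0 add0r.
(* Here i and j are [a] and [b] in some order: U X + X U has the entry X_ji at both cloned
   positions. *)
exists U, U, 2%:R; first by rewrite k0.
split; first by rewrite -/t t0 addr0.
  have E p : (delta_mx i j *m X + X *m delta_mx i j) p p =
      (p == i)%:R * X j p + X p i * (p == j)%:R.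
    by rewrite mxE mul_deltaE mul_mx_deltaE.
  rewrite UE map_delta_mx /cloned !E.
  move: iab jab ij; rewrite !inE => /orP[]/eqP-> /orP[]/eqP->; rewrite ?eqxx //= => _;
  by rewrite ?(negPf ab) ?[b == a]eq_sym ?(negPf ab) !mul0r !mulr0 !mul1r !mulr1 ?addr0 ?add0r.
by rewrite raddf0 subr0 scaler_nat mulr2n.
Qed.

End ClonedFields.

Section ClonedLinearRank.
Variables (k : fieldType) (m n : nat) (a b : 'I_m).
Variables (idx : 'I_m -> 'I_m -> 'I_n) (pos : 'I_n -> 'I_m * 'I_m).
Hypothesis hk : [pchar k] =i pred0.
Hypothesis hp : clone_pattern a b idx pos.
Local Notation R := {mpoly k[n]}.
Local Notation X := (cloned_mx k idx).
Local Notation f := (cloned_det k idx).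
Local Notation F := (gradient f).
Local Notation lift := (map_mx (@mpolyC n k)).

(** The derivative of the determinant along the field A Y + Y B, computed as a trace against the
    adjugate. *)
Lemma tr_field (T : comNzRingType) (Y A B : 'M[T]_m) :
  \sum_i \sum_j (A *m Y + Y *m B) i j * (\adj Y)^T i j =
  (\tr A + \tr B) * \det Y.
Proof.
transitivity (\tr ((A *m Y + Y *m B) *m \adj Y)).
  apply: eq_bigr => i _; rewrite mxE; apply: eq_bigr => j _.
  by rewrite [_^T i j]mxE.
rewrite mulmxDl linearD /= -mulmxA mul_mx_adj mxtrace_mulC mul_scalar_mx.
rewrite -mulmxA mxtrace_mulC -mulmxA mul_adj_mx mul_mx_scalar !linearZ /=.
by rewrite mulrDl ![\det Y * _]mulrC.
Qed.

Lemma cloned_field_syzygy (A B : 'M[k]_m) : \tr A + \tr B = 0 ->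
    cloned a b (lift A *m X + X *m lift B) ->
  linear_syzygy F (\col_w coords pos (lift A *m X + X *m lift B) w).
Proof.
move=> trAB cZ; split=> [w|].
  rewrite mxE /coords mxE; apply: rpredD; rewrite mxE; apply: rpred_sum => l _.
    rewrite [lift A _ _]mxE mul_mpolyC; apply: rpredZ; exact: dhomog_cloned_mx.
  rewrite [lift B _ _]mxE mulrC mul_mpolyC; apply: rpredZ; exact: dhomog_cloned_mx.
under eq_bigr => w _ do rewrite mxE tnth_mktuple mderiv_cloned_det.
rewrite (sum_coords hp _ cZ) tr_field !trace_map_mx.
by rewrite -(rmorphD (@mpolyC n k)) trAB rmorph0 mul0r.
Qed.

(** At the identity matrix the field of v is [x v] times the direction of v minus [t v] times the
    identity. A left kernel vector u thus satisfies [x v * u v = t v * s], with s its pairing with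
    the identity, so this kernel is at most a line. *)
Lemma cloned_linear_rank : linear_syzygies_have_rank F n.-1.
Proof.
have cX := cloned_mx_cloned k hp.
have [A hA] := fin_all_exists (fun v => cloned_field hp (@mpolyC n k) v hk cX).
have [B hB] := fin_all_exists hA; have [x x0 hx] := fin_all_exists2 hB.
pose Z (v : 'I_n) : 'M[R]_m := lift (A v) *m X + X *m lift (B v).
pose t (v : 'I_n) : k := \tr (fiber_mx idx k v).
apply: (linear_rank_point (M := \matrix_(w, v) coords pos (Z v) w)
  (x := id_point k pos) (w := fun v => t v / x v)).
- by exists (idx a a); rewrite tnth_mktuple (gradient_neq0 hk hp).
- move=> v; have [trAB cZ _] := hx v; have := cloned_field_syzygy trAB cZ.
  by have -> : \col_w coords pos (Z v) w = col v (\matrix_(w, v) coords pos (Z v) w)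
    by apply/colP=> w; rewrite !mxE.
move=> u uM; exists (\sum_w u 0 w * coords pos 1%:M w) => v.
have [_ _ AB] := hx v.
have ZE : map_mx (meval (id_point k pos)) (Z v) = A v + B v.
  have liftK C : map_mx (meval (id_point k pos)) (lift C) = C.
    by apply/matrixP=> i j; rewrite !mxE mevalC.
  by rewrite map_mxD !map_mxM !liftK (cloned_mx_id k hp) mul1mx mulmx1.
have : \sum_w u 0 w * coords pos (A v + B v) w = 0.
  move/rowP: uM => /(_ v); rewrite mxE [RHS]mxE => uv; apply: etrans uv; apply: eq_bigr => w _.
  by rewrite -ZE [map_mx _ (\matrix_(_, _) _) w v]mxE [in RHS]mxE /coords [in LHS]mxE.
have ABE w : coords pos (A v + B v) w = x v * (w == v)%:R - t v * coords pos 1%:M w.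
  by rewrite AB /coords !mxE (clone_posK hp) [t v * _]mulr_natr.
under eq_bigr => w _ do rewrite ABE mulrBr.
rewrite sumrB (bigD1 v) //= eqxx mulr1 big1 ?addr0 => [|w /negPf wv]; last first.
  by rewrite wv !mulr0.
under eq_bigr => w _ do rewrite mulrCA.
rewrite -mulr_sumr => /eqP; rewrite subr_eq0 => /eqP uE.
by rewrite mulrA [_ * t v]mulrC -uE mulfK.
Qed.

End ClonedLinearRank.

(** * Irreducibility *)

Section CornerMatrix.
Variables (T : comNzRingType) (m : nat) (a b : 'I_m) (x : T).
Hypothesis ab : a != b.

Definition corner_mx : 'M[T]_m := \matrix_(i, j)
  if (i == a) && (j == b) then 1 else
  if (i == b) && (j == a) then x ^+ 2 - 1 else
  if (i == j) && ((i == a) || (i == b)) then x else (i == j)%:R.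

Lemma corner_mx_diag i : (i == a) || (i == b) -> corner_mx i i = x.
Proof.
by move=> iab; rewrite mxE eqxx iab /=; case/orP: iab => /eqP->;
  rewrite eqxx ?(negPf ab) // [b == a]eq_sym (negPf ab).
Qed.

(** Only the identity and the transposition of [a] and [b] contribute: x^2 - (x^2 - 1) = 1. *)
Lemma det_corner_mx : \det corner_mx = 1.
Proof.
have ba : b != a by rewrite eq_sym.
have other i j : i != a -> i != b -> corner_mx i j = (i == j)%:R.
  by move=> /negPf ia /negPf ib; rewrite mxE ia ib andbF.
have prodE (s : 'S_m) : (forall i, i != a -> i != b -> s i = i) ->
    \prod_i corner_mx i (s i) = corner_mx a (s a) * corner_mx b (s b).
  move=> sfix; rewrite (bigD1 a) //= (bigD1 b) //= mulrA big1 ?mulr1 // => i /andP[ia ib].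
  by rewrite sfix // other // eqxx.
have st : (1%g : 'S_m) != tperm a b.
  by apply: contraNneq ab => /permP/(_ a); rewrite perm1 tpermL => <-.
rewrite /determinant (bigD1 1%g) //= (bigD1 (tperm a b)) 1?eq_sym //=.
rewrite odd_perm1 odd_tperm ab /= !prodE => [||i _ _]; last by rewrite perm1.
  2: by move=> i ia ib; rewrite tpermD // eq_sym.
rewrite !perm1 tpermL tpermR big1 => [|s /andP[s1 sab]].
  rewrite !mxE !eqxx (negPf ab) (negPf ba) /= ?orbT ?andbF /=.
  by rewrite addr0 expr0 expr1; ring.
suff [i /andP[/andP[ia ib] si]] : exists i, (i != a) && (i != b) && (s i != i).
  by rewrite (bigD1 i) //= other // eq_sym (negPf si) mul0r mulr0.
apply/existsP; apply: contraNT s1; rewrite negb_exists => /forallP sfix.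
have {}sfix i : i != a -> i != b -> s i = i.
  by move=> ia ib; have := sfix i; rewrite ia ib /= negbK => /eqP.
have s_ab i : (i == a) || (i == b) -> (s i == a) || (s i == b).
  apply: contraTT; rewrite !negb_or => /andP[sa sb].
  by have /perm_inj si := sfix _ sa sb; rewrite si in sa sb; rewrite sa.
have sa := s_ab a; have sb := s_ab b; rewrite !eqxx ?orbT in sa sb.
have sab' : s a != s b by rewrite (inj_eq perm_inj).
case/orP: (sa isT) => /eqP sa'; case/orP: (sb isT) => /eqP sb'.
- by rewrite sa' sb' eqxx in sab'.
- apply/eqP/permP=> i; rewrite perm1; have [->//|ia] := eqVneq i a.
  by have [->//|ib] := eqVneq i b; exact: sfix.
- case/eqP: sab; apply/permP=> i; have [->|ia] := eqVneq i a; first by rewrite tpermL.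
  have [->|ib] := eqVneq i b; first by rewrite tpermR.
  by rewrite tpermD 1?eq_sym // sfix.
- by rewrite sa' sb' eqxx in sab'.
Qed.

End CornerMatrix.

(** The entry (a, a) is kept, so that a cloned matrix stays cloned. *)
Definition replace_row (T : comNzRingType) m (Z : 'M[T]_m) a (c : 'I_m -> T) : 'M[T]_m :=
  \matrix_(i, j) if (i == a) && (j != a) then c j else Z i j.

Lemma det_replace_row (T : comNzRingType) m (Z : 'M[T]_m) a c :
  \det (replace_row Z a c) =
  Z a a * cofactor Z a a + \sum_(j | j != a) c j * cofactor Z a j.
Proof.
have cofE j : cofactor (replace_row Z a c) a j = cofactor Z a j.
  by apply: cofactor_eq => i' j' /negPf ia _; rewrite mxE ia.
rewrite (expand_det_row _ a) (bigD1 a) //= cofE mxE eqxx; congr (_ + _).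
by apply: eq_bigr => j ja; rewrite cofE mxE eqxx ja.
Qed.

Lemma sum_indicator (T : comNzRingType) (I : finType) (P : pred I) (x : I -> T) j :
  P j -> \sum_(i | P i) (i == j)%:R * x i = x j.
Proof.
move=> Pj; rewrite (bigD1 j) //= eqxx mul1r big1 ?addr0 // => i /andP[_ /negPf ->].
by rewrite mul0r.
Qed.

Lemma size_poly_sum_le (T : nzRingType) (I : Type) (s : seq I) (P : I -> {poly T}) d :
  (forall i, (size (P i) <= d)%N) -> (size (\sum_(i <- s) P i)%R <= d)%N.
Proof.
move=> hP; apply: (big_ind (fun p : {poly T} => size p <= d)%N) => [|p q hp hq|i _] //.
  by rewrite size_poly0.
by apply: leq_trans (size_polyD _ _) _; rewrite geq_max hp.
Qed.

Lemma cofactor_polyC (T : comNzRingType) m (Z : 'M[{poly T}]_m) (W : 'M[T]_m) i j :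
    (forall i' j', i' != i -> j' != j -> Z i' j' = (W i' j')%:P) ->
  cofactor Z i j = (cofactor W i j)%:P.
Proof.
move=> ZW; rewrite -(cofactor_map_mx (@polyC T)); apply: cofactor_eq => i' j' ii' jj'.
by rewrite mxE ZW.
Qed.

Lemma size_det_row (T : comNzRingType) m (Z : 'M[{poly T}]_m) (W : 'M[T]_m) a :
    (forall l, exists x (e : bool), Z a l = x%:P * 'X ^+ e) ->
    (forall i j, i != a -> Z i j = (W i j)%:P) ->
  (size (\det Z) <= 2)%N.
Proof.
move=> Za ZW; rewrite (expand_det_row _ a); apply: size_poly_sum_le => l.
rewrite (cofactor_polyC (W := W)) => [|i' j' ia _]; last exact: ZW.
have [x [e ->]] := Za l; rewrite mulrAC -polyCM mul_polyC.
apply: leq_trans (size_scale_leq _ _) _; rewrite size_polyXn.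
by case: e.
Qed.

Section ClonedIrreducible.
Variables (k : fieldType) (m n : nat) (a b : 'I_m).
Variables (idx : 'I_m -> 'I_m -> 'I_n) (pos : 'I_n -> 'I_m * 'I_m).
Hypothesis hk : [pchar k] =i pred0.
Hypothesis hp : clone_pattern a b idx pos.
Local Notation R := {mpoly k[n]}.
Local Notation X := (cloned_mx k idx).
Local Notation f := (cloned_det k idx).
Let ab : a != b := clone_neq hp.

Definition row_vars : pred 'I_n := [pred v | [exists j, (j != a) && (v == idx a j)]].
Definition col_vars j : pred 'I_n :=
  [pred v | [exists i, v == idx i j] && (v != idx a a)].

Lemma row_vars_other i j : i != a -> ~~ row_vars (idx i j).
Proof.
move=> ia; apply: contraT => /negPn/existsP[l /andP[la /eqP]].
case/(clone_inj hp)=> [[ia' _]|/andP[_ /andP[/eqP al _]]].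
  by rewrite ia' eqxx in ia.
by rewrite al eqxx in la.
Qed.

Lemma row_varsE j : j != a -> row_vars (idx a j).
Proof. by move=> ja; apply/existsP; exists j; rewrite ja eqxx. Qed.

Lemma col_vars_other i j l : j != l -> ~~ col_vars l (idx i j).
Proof.
move=> jl; rewrite negb_and; apply/orP.
have [/(clone_posP hp) ->|cij] := boolP (clone_pos a b i j); first by right; rewrite eqxx.
left; apply/existsPn=> i'; rewrite eq_sym (idx_other hp) //.
by rewrite [l == j]eq_sym (negPf jl) andbF.
Qed.

Lemma scale_vars_cloned_mx S i j :
  map_mx (scale_vars (k := k) S) X i j = ('X_(idx i j))%:P * 'X ^+ S (idx i j).
Proof. by rewrite !mxE scale_varsX. Qed.

Lemma scale_vars_cloned_mx0 S i j : ~~ S (idx i j) ->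
  map_mx (scale_vars (k := k) S) X i j = (X i j)%:P.
Proof. by move=> /negPf Sij; rewrite scale_vars_cloned_mx Sij expr0 mulr1 mxE. Qed.

Lemma size_row_vars : (size (scale_vars row_vars f) <= 2)%N.
Proof.
have -> : scale_vars row_vars f = \det (map_mx (scale_vars row_vars) X).
  exact/esym/det_map_mx.
apply: (size_det_row (W := X) (a := a)).
  by move=> l; exists 'X_(idx a l), (row_vars (idx a l)); exact: scale_vars_cloned_mx.
by move=> i j ia; apply: scale_vars_cloned_mx0; exact: row_vars_other.
Qed.

Lemma size_col_vars j : (size (scale_vars (col_vars j) (cofactor X a j)) <= 1)%N.
Proof.
have -> : scale_vars (col_vars j) (cofactor X a j) =
    cofactor (map_mx (scale_vars (col_vars j)) X) a j.
  exact/esym/cofactor_map_mx.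
rewrite (cofactor_polyC (W := X)).
  exact: size_polyC_leq1.
by move=> i' j' _ jj'; apply: scale_vars_cloned_mx0; exact: col_vars_other.
Qed.

Lemma cofactor_gradient j : j != a -> cofactor X a j = f^`M(idx a j).
Proof.
move=> ja; rewrite mderiv_cloned_det (fiber_sum_other hp) ?mxE //.
by rewrite /clone_pos eq_sym (negPf ja).
Qed.

Lemma cofactor_neq0 j : cofactor X a j != 0.
Proof.
have [->|ja] := eqVneq j a; last by rewrite cofactor_gradient // (gradient_neq0 hk hp).
have : (\adj X a a).@[id_point k pos] = 1.
  transitivity (map_mx (meval (id_point k pos)) (\adj X) a a); first by rewrite [RHS]mxE.
  by rewrite map_mx_adj (cloned_mx_id k hp) adj1 mxE eqxx.
rewrite mxE => h; apply: contra_eq_neq h => ->.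
by rewrite meval0 eq_sym oner_eq0.
Qed.

Lemma cloned_det_row (c : 'I_m -> R) : exists2 s : n.-tuple R,
    (forall v, ~~ row_vars v -> tnth s v = 'X_v)
  & f \mPo s = X a a * cofactor X a a + \sum_(j | j != a) c j * cofactor X a j.
Proof.
pose Z : 'M[R]_m := replace_row X a c.
have Zother i j : i != a -> Z i j = X i j by move=> /negPf ia; rewrite mxE ia.
have cZ : cloned a b Z.
  have Zbb : Z b b = X b b by apply: Zother; rewrite eq_sym.
  by rewrite /cloned Zbb mxE eqxx; exact: (cloned_mx_cloned k hp).
exists [tuple coords pos Z v | v < n] => [v|].
  rewrite tnth_mktuple; elim/(idx_ind hp): v => [_|i j _ rij].
    by rewrite (coordsE hp) // mxE !eqxx /= mxE.
  rewrite (coordsE hp) // mxE; case: ifP => [/andP[/eqP ia ja]|_]; last by rewrite mxE.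
  by rewrite ia row_varsE in rij.
set s := [tuple _ | _ < _].
have -> : f \mPo s = \det Z.
  rewrite -(det_map_mx (comp_mpoly s)) (cloned_mx_point hp cZ) // => v.
  by rewrite /= comp_mpolyXU -tnth_nth tnth_mktuple.
exact: det_replace_row.
Qed.

(** Substitutions in row [a] fix [p], so [p] divides every value produced by [cloned_det_row];
    taking [c] zero or a unit vector isolates single cofactors. *)
Lemma row_free_factor_unit (p q : R) : f = p * q -> free row_vars p ->
  p \is a GRing.unit.
Proof.
move=> fpq pS.
have sub (c : 'I_m -> R) : exists r, p * r =
    X a a * cofactor X a a + \sum_(j | j != a) c j * cofactor X a j.
  have [s s_out <-] := cloned_det_row c; exists (q \mPo s).
  by rewrite fpq rmorphM /= (free_comp pS s_out).
have [r0 r0E] : exists r, p * r = X a a * cofactor X a a.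
  have [r rE] := sub (fun=> 0); exists r; rewrite rE big1 ?addr0 // => j _.
  by rewrite mul0r.
have col j : free (col_vars j) p.
  have [->|ja] := eqVneq j a.
    apply: (free_factor (q := r0)); rewrite r0E.
      by rewrite mulf_neq0 ?cofactor_neq0 // mxE mpolyXU_neq0.
    rewrite rmorphM /=.
    have -> : scale_vars (col_vars a) (X a a) = (X a a)%:P.
      rewrite -[RHS](scale_vars_cloned_mx0 (S := col_vars a)) ?mxE //.
      by rewrite negb_and eqxx orbT.
    by rewrite mul_polyC; apply: leq_trans (size_scale_leq _ _) (size_col_vars a).
  have [r rE] := sub (fun l => (l == j)%:R).
  have cofE : p * (r - r0) = cofactor X a j.
    by rewrite mulrBr rE r0E addrAC subrr add0r sum_indicator.
  by apply: (free_factor (q := r - r0)); rewrite cofE ?cofactor_neq0 ?size_col_vars.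
(* Every variable except the cloned one lies in some [col_vars j]. The substitution of the corner
   matrix fixes the cloned variable, hence [p], and sends [f] to 1. *)
have all_free := free_has (s := enum 'I_m) (fun j _ => col j).
pose Z : 'M[R]_m := corner_mx a b 'X_(idx a a).
have cZ : cloned a b Z.
  by rewrite /cloned !corner_mx_diag ?eqxx ?orbT.
pose s := [tuple coords pos Z v | v < n].
have fs : f \mPo s = 1.
  rewrite -(det_map_mx (comp_mpoly s)) (cloned_mx_point hp cZ) ?det_corner_mx // => v.
  by rewrite /= comp_mpolyXU -tnth_nth tnth_mktuple.
have ps : p \mPo s = p.
  apply: (free_comp all_free) => v; elim/(idx_ind hp): v => [_|i j cij /hasPn].
    by rewrite tnth_mktuple (coordsE hp) // corner_mx_diag ?eqxx.
  have cv : col_vars j (idx i j).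
    apply/andP; split; first by apply/existsP; exists i.
    by apply: contraNneq cij => /(clone_posP hp).
  by move=> /(_ j (mem_enum _ _)); rewrite cv.
by apply/unitrPr; exists (q \mPo s); rewrite -{1}ps -fs fpq rmorphM.
Qed.

Lemma cloned_det_irreducible : irreducible_element f.
Proof.
split; first exact: (cloned_det_neq0 k hp).
  (* [f] vanishes at the origin, hence is not a unit. *)
  apply/negP=> /(rmorph_unit (meval (fun=> 0 : k))).
  rewrite -(det_map_mx (meval (fun=> 0 : k))).
  have -> : map_mx (meval (fun=> 0 : k)) X = 0%:M.
    by apply/matrixP=> i j; rewrite !mxE mevalXU mul0rn.
  by rewrite det_scalar expr0n (gtn_eqF (ltnW (clone_size hp))) unitr0.
move=> p q fpq; have f0 := cloned_det_neq0 k hp.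
have := size_row_vars; rewrite fpq => /free_factor2[|pS|qS]; first by rewrite -fpq.
  by left; exact: row_free_factor_unit fpq pS.
by right; apply: (row_free_factor_unit (q := p)) qS; rewrite mulrC.
Qed.

End ClonedIrreducible.

(** * The row-by-row numbering as a clone pattern, and the conclusion *)

Lemma cloned_generic_pattern m (hm : (2 <= m)%N) : exists (a b : 'I_m) pos,
  clone_pattern a b (fun i j => Ordinal (cloned_index_lt hm i j)) pos.
Proof.
have m0 : (0 < m)%N := ltnW hm.
have am : (m - 2 < m)%N by rewrite ltn_subrL m0.
have bm : (m.-1 < m)%N by rewrite prednK.
pose a := Ordinal am; pose b := Ordinal bm.
have ab_lt : (m - 2 < m.-1)%N by rewrite -subn1 ltn_sub2l.
have vm (v : 'I_(m ^ 2 - 1)) : (v %/ m < m)%N.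
  by rewrite ltn_divLR // mulnn (leq_trans (ltn_ord v)) ?leq_subr.
pose pos (v : 'I_(m ^ 2 - 1)) := (Ordinal (vm v), Ordinal (ltn_pmod v m0)).
exists a, b, pos.
have other (i j : 'I_m) : ~~ ((i == b) && (j == b)) ->
    cloned_index i j = (i * m + j)%N.
  by rewrite /cloned_index -!val_eqE /= => /negPf ->.
have bb : cloned_index b b = (m - 2 + (m - 2) * m)%N.
  by rewrite /cloned_index /= !eqxx addnC.
have ab : a != b by rewrite -val_eqE /= ltn_eqF.
have aa : cloned_index a a = (m - 2 + (m - 2) * m)%N.
  by rewrite other ?(negPf ab) // addnC.
have base (i j i' j' : 'I_m) : (i * m + j = i' * m + j')%N -> (i, j) = (i', j').
  move=> e; congr (_, _); apply: val_inj => /=.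
    by have := congr1 (divn^~ m) e; rewrite !divnMDl // !divn_small ?addn0.
  by have := congr1 (modn^~ m) e; rewrite !modnMDl !modn_small.
have atbb (i j : 'I_m) : cloned_index b b = (i * m + j)%N -> (i, j) = (a, a).
  by rewrite bb -aa other ?(negPf ab) // => /base->.
split=> // [|i j i' j' /(congr1 val) /=|v]; first by apply: val_inj; rewrite /= aa bb.
- have cbb : clone_pos a b b b by rewrite /clone_pos !eqxx orbT.
  have caa : clone_pos a b a a by rewrite /clone_pos !eqxx.
  case: (boolP ((i == b) && (j == b))) => [/andP[/eqP-> /eqP->]|ij];
  case: (boolP ((i' == b) && (j' == b))) => [/andP[/eqP-> /eqP->]|ij'].
  + by left.
  + by rewrite (other i') // => /atbb[-> ->]; right; rewrite cbb caa.
  + by rewrite (other i) // => /esym/atbb[-> ->]; right; rewrite cbb caa.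
  + by rewrite !other // => /base; left.
apply: val_inj => /=; rewrite other /= -?divn_eq //.
(* Position (b, b) would carry the number m^2 - 1, which is out of range. *)
apply/negP=> /andP[/eqP/(congr1 val) /= vd /eqP/(congr1 val) /= vr].
have := ltn_ord v; rewrite (divn_eq v m) vd vr -mulnn.
have -> : (m * m - 1 = m.-1 * m + m.-1)%N; last by rewrite ltnn.
by case: (m) (m0) => // p _; rewrite [in LHS]mulSn addSn subn1 addnC.
Qed.

Theorem theorem2p3 (k : fieldType) (hk : [pchar k] =i pred0)
    (m : nat) (hm : (2 <= m)%N) :
  let f : {mpoly k[m ^ 2 - 1]} := \det (cloned_generic_matrix hm k) in
  [/\ irreducible_element f,
      hessian_det f != 0,
      has_linear_rank (gradient_ideal f) (m ^ 2 - 1) (m ^ 2 - 2)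
    & homaloidal f].
Proof.
have [a [b [pos hp]]] := cloned_generic_pattern hm.
split.
- exact: (cloned_det_irreducible hk hp).
- exact: (cloned_det_hessian hk hp).
- exists (gradient (\det (cloned_generic_matrix hm k))), m.-1; split.
  + by move=> v; rewrite tnth_mktuple; exact: dhomog_gradient.
  + exact: (cloned_gradient_minimal hk hp).
  + by have := cloned_linear_rank hk hp; rewrite -subn1 -subnDA.
- exact: (cloned_det_homaloidal hk hp).
Qed.
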